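(* 1. Applying the inverse of $\mathcal{P}^{\mathrm{hook}}:=\mathcal{P}^{\mathrm{hook}}_{\le R}$ to a vector, by the recursive procedure described in the context, requires exactly one solution of a system involving $B_i$ for each vertex $i\in\mathbb{V}$. 2. Applying the inverse of $\mathcal{P}^{\mathrm{exact}}:=\mathcal{P}^{\mathrm{exact}}_{\le R}$ to a vector, by the recursive procedure described in the context, requires $\Theta(2^{\mathrm{depth}(i)})$ solutions of systems involving $B_i$ for each vertex $i\in\mathbb{V}$; that is, there are absolute constants $0<c\le C$ such that this number lies between $c\,2^{\mathrm{depth}(i)}$ and $C\,2^{\mathrm{depth}(i)}$.
   Context: **Data.** Let $\mathbb{D}=(\mathbb{V},\mathbb{A})$ be a directed rooted tree (arborescence) with vertices $\mathbb{V}=\{1,\dots,N\}$ and arcs $\mathbb{A}=\{a_1,\dots,a_M\}$ directed away from the root $R$. Each vertex $i$ has a symmetric matrix $B_i\in\mathbb{R}^{n_i\times n_i}$; each arc $a_k=(i,j)$ has a symmetric $D_k\in\mathbb{R}^{\ell_k\times\ell_k}$ and matrices $C_k^+\in\mathbb{R}^{\ell_k\times n_i}$, $C_k^-\in\mathbb{R}^{\ell_k\times n_j}$. A vertex is a leaf if it has no outgoing arcs, and an inner vertex otherwise; $\mathrm{depth}(i)$ is the length of the path from $R$ to $i$. For $i\neq R$ let $\kappa(i)$ be the index of the unique arc entering $i$. For an inner vertex $i$ write its outgoing arcs as $a_{k_1}=(i,j_1),\dots,a_{k_r}=(i,j_r)$. **Nested matrices.** For a leaf $i$: $\mathcal{B}_{\le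 i}=B_i$, and $\mathcal{C}_i^-=C^-_{\kappa(i)}$ if $i\ne R$. For an inner vertex $i$: $\mathcal{D}_{\le i}=\mathrm{blkdiag}(D_{k_1},\dots,D_{k_r})$, $\mathcal{C}^+_{\le i}$ is the vertical stacking of $C^+_{k_1},\dots,C^+_{k_r}$, $\mathcal{C}^-_{\le i}=\mathrm{blkdiag}(\mathcal{C}^-_{j_1},\dots,\mathcal{C}^-_{j_r})$, and $$\mathcal{B}_{\le i}=\begin{pmatrix}\mathrm{blkdiag}(\mathcal{B}_{\le j_1},\dots,\mathcal{B}_{\le j_r}) & 0 & -(\mathcal{C}^-_{\le i})^T\\ 0 & B_i & (\mathcal{C}^+_{\le i})^T\\ -\mathcal{C}^-_{\le i} & \mathcal{C}^+_{\le i} & -\mathcal{D}_{\le i}\end{pmatrix};$$ for $i\neq R$, $\mathcal{C}_i^-=(0\ \cdots\ 0\ C^-_{\kappa(i)}\ 0)$, where $C^-_{\kappa(i)}$ occupies the columns of $\mathcal{B}_{\le i}$ containing the diagonal block $B_i$. For inner $i$, $$\mathcal{S}_{\le i}=\begin{pmatrix}-\mathcal{C}^-_{\le i}&\mathcal{C}^+_{\le i}\end{pmatrix}\mathrm{blkdiag}(\mathcal{B}_{\le j_1}^{-1},\dots,\mathcal{B}_{\le j_r}^{-1},B_i^{-1})\begin{pmatrix}-\mathcal{C}^-_{\le i}&\mathcal{C}^+_{\le i}\end{pmatrix}^T+\mathcal{D}_{\le i}.$$ **Standing assumptions.** All $B_i$ and all $\mathcal{B}_{\le i}$ are invertible, and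 all $\mathcal{S}_{\le i}$ ($i$ inner) are positive definite. Moreover, with $\mathcal{B}=\mathrm{blkdiag}(B_1,\dots,B_N)$, $\mathcal{D}=\mathrm{blkdiag}(D_1,\dots,D_M)$ and $\mathcal{C}$ the block matrix whose block row for $a_k=(i,j)$ has $C_k^+$ in block column $i$, $-C_k^-$ in block column $j$ and zeros elsewhere, the matrix $\mathcal{C}\mathcal{B}^{-1}\mathcal{C}^T+\mathcal{D}$ is positive definite. **Preconditioners.** For invertible matrices $Q_l$ of the size of $\mathcal{B}_{\le j_l}$ put $$H_i(Q_1,\dots,Q_r)=\begin{pmatrix}\mathrm{blkdiag}(Q_1,\dots,Q_r) & 0 & 0\\ 0 & B_i & 0\\ -\mathcal{C}^-_{\le i} & \mathcal{C}^+_{\le i} & -\mathcal{S}_{\le i}\end{pmatrix}.$$ For leaves, $\mathcal{P}^{\mathrm{hook}}_{\le i}=\mathcal{P}^{\mathrm{exact}}_{\le i}=B_i$. For inner $i$, $\mathcal{P}^{\mathrm{hook}}_{\le i}=H_i(\mathcal{P}^{\mathrm{hook}}_{\le j_1},\dots,\mathcal{P}^{\mathrm{hook}}_{\le j_r})$; and with $\mathcal{P}^{\mathrm{rec}}_{\le i}=H_i(\mathcal{P}^{\mathrm{exact}}_{\le j_1},\dots,\mathcal{P}^{\mathrm{exact}}_{\le j_r})$, $\mathcal{P}^{\mathrm{exact}}_{\le i}$ is defined by $(\mathcal{P}^{\mathrm{exact}}_{\le i})^{-1}=(2I-(\mathcal{P}^{\mathrm{rec}}_{\le i})^{-1}\mathcal{B}_{\le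 i})(\mathcal{P}^{\mathrm{rec}}_{\le i})^{-1}$. **Application procedures.** The inverse of $H_i(Q_1,\dots,Q_r)$ is applied to a vector $(g_1,\dots,g_r,h_i,f)$ as follows: compute $x_l=Q_l^{-1}g_l$ once for each $l$ (recursively by the same type of procedure), compute $x_i=B_i^{-1}h_i$, form $\hat z=-\mathcal{C}^-_{\le i}(x_1,\dots,x_r)+\mathcal{C}^+_{\le i}x_i-f$, and compute $\mathcal{S}_{\le i}^{-1}\hat z$. The inverse of $\mathcal{P}^{\mathrm{hook}}_{\le i}$ is applied this way at inner vertices, and by one solve with $B_i$ at leaves. The inverse of $\mathcal{P}^{\mathrm{exact}}_{\le i}$ is applied to $h$ by one solve with $B_i$ at leaves and, at inner vertices, by computing $w=(\mathcal{P}^{\mathrm{rec}}_{\le i})^{-1}h$ and then $2w-(\mathcal{P}^{\mathrm{rec}}_{\le i})^{-1}(\mathcal{B}_{\le i}w)$, i.e. with two applications of $(\mathcal{P}^{\mathrm{rec}}_{\le i})^{-1}$. **Counting.** A ''solution of a system involving $B_i$'' is the computation of $B_i^{-1}g$ for one vector $g$; the Schur complements $\mathcal{S}_{\le i}$ are precomputed, and neither their computation, solves with them, nor matrix–vector products are counted. *)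

(* Defs.v *)
From mathcomp Require Import all_boot all_order all_algebra.
From mathcomp Require Import reals.

Set Implicit Arguments.
Unset Strict Implicit.
Unset Printing Implicit Defensive.
Import Order.TTheory GRing.Theory Num.Theory.
Local Open Scope ring_scope.

(** * Rooted directed trees

    The arc [k] goes from [tl k] to [hd k]; a walk is given by its list of arcs.
    Vertices and arcs are numbered from 0. *)

Fixpoint walk (N M : nat) (tl hd : 'I_M -> 'I_N) (u : 'I_N)
    (p : seq 'I_M) (v : 'I_N) : bool :=
  if p is k :: p' then (tl k == u) && walk tl hd (hd k) p' v
  else u == v.

Record arborescence (N M : nat) := Arborescence {
  arb_tail : 'I_M -> 'I_N;
  arb_head : 'I_M -> 'I_N;
  arb_root : 'I_N;
  arb_walk : forall v : 'I_N,
    exists! p : seq 'I_M, walk arb_tail arb_head arb_root p v }.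

Lemma arb_reach (N M : nat) (T : arborescence N M) (v : 'I_N) :
  exists p : seq 'I_M, walk (arb_tail T) (arb_head T) (arb_root T) p v.
Proof. by have [p [wp _]] := arb_walk T v; exists p. Qed.

Definition depth (N M : nat) (T : arborescence N M) (v : 'I_N) : nat :=
  size (xchoose (arb_reach T v)).

Definition out (N M : nat) (T : arborescence N M) (i : 'I_N) : {set 'I_M} :=
  [set k | arb_tail T k == i].

Definition leaf (N M : nat) (T : arborescence N M) (i : 'I_N) : bool :=
  out T i == set0.

Definition out_arc (N M : nat) (T : arborescence N M) (i : 'I_N)
  (l : 'I_#|out T i|) : 'I_M := enum_val l.

Definition kid (N M : nat) (T : arborescence N M) (i : 'I_N)
  (l : 'I_#|out T i|) : 'I_N := arb_head T (out_arc l).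

Lemma tail_out_arc (N M : nat) (T : arborescence N M) (i : 'I_N)
  (l : 'I_#|out T i|) : arb_tail T (out_arc l) = i.
Proof. by have := enum_valP l; rewrite inE => /eqP. Qed.

(** The subtree below a vertex, as an inductive object along which the nested
    matrices are defined by structural recursion.  Each vertex of an
    arborescence has such a subtree, [subtree_of] below. *)
Inductive subtree (N M : nat) (T : arborescence N M) : 'I_N -> Type :=
| Leaf i of leaf T i : subtree T i
| Inner i of ~~ leaf T i & (forall l : 'I_#|out T i|, subtree T (kid l)) :
    subtree T i.

Definition child (N M : nat) (T : arborescence N M) (j i : 'I_N) : Prop :=
  exists2 k, arb_tail T k = i & arb_head T k = j.

Lemma walk_cat (N M : nat) (tl hd : 'I_M -> 'I_N) u p q v :
  walk tl hd u (p ++ q) v = [exists w, walk tl hd u p w && walk tl hd w q v].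
Proof.
elim: p u => [|k p IH] u /=.
  apply/idP/existsP => [h|[w /andP[/eqP-> //]]].
  by exists u; rewrite eqxx.
rewrite IH; apply/andP/existsP.
  by move=> [tk /existsP[w /andP[h1 h2]]]; exists w; rewrite tk h1.
move=> [w /andP[/andP[tk h1] h2]]; split=> //.
by apply/existsP; exists w; rewrite h1.
Qed.

Lemma walk_fun (N M : nat) (tl hd : 'I_M -> 'I_N) u p v w :
  walk tl hd u p v -> walk tl hd u p w -> v = w.
Proof.
elim: p u => [|k p IH] u /=; first by move=> /eqP <- /eqP.
by move=> /andP[_ h] /andP[_ h']; exact: IH h h'.
Qed.

Lemma walk_size (N M : nat) (T : arborescence N M) p v :
  walk (arb_tail T) (arb_head T) (arb_root T) p v -> (size p < N)%N.
Proof.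
move=> wp; rewrite ltnNge; apply/negP => szp.
have wt (n : 'I_N.+1) : exists w,
    walk (arb_tail T) (arb_head T) (arb_root T) (take n p) w.
  move: wp; rewrite -{1}(cat_take_drop n p) walk_cat => /existsP[w /andP[h _]].
  by exists w.
pose f n := xchoose (wt n).
suff : injective f by move=> /leq_card; rewrite !card_ord ltnn.
move=> a b fab; apply: val_inj => /=.
have ha := xchooseP (wt a); have hb := xchooseP (wt b).
rewrite -/(f a) fab in ha; rewrite -/(f b) in hb.
have [p0 [_ u0]] := arb_walk T (f b).
have := congr1 size (etrans (esym (u0 _ ha)) (u0 _ hb)).
by rewrite !size_takel // (leq_trans _ szp) // -ltnS.
Qed.

Lemma child_wf (N M : nat) (T : arborescence N M) : well_founded (child T).
Proof.
move=> v.
suff H n : forall p v, walk (arb_tail T) (arb_head T) (arb_root T) p v ->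
    (N - size p < n)%N -> Acc (child T) v.
  by have [p wp] := arb_reach T v; apply: (H _ _ _ wp (ltnSn _)).
elim: n => [//|n IH] p {}v wp hn.
constructor=> j [k tk hk].
have wk : walk (arb_tail T) (arb_head T) (arb_root T) (rcons p k) j.
  rewrite -cats1 walk_cat; apply/existsP; exists v.
  by rewrite wp /= tk hk !eqxx.
apply: (IH _ _ wk); rewrite size_rcons.
have := walk_size wp; have := walk_size wk; rewrite size_rcons => h1 h2.
by rewrite -ltnS (leq_trans _ hn) // ltnS ltn_sub2l.
Qed.

Lemma kid_child (N M : nat) (T : arborescence N M) (i : 'I_N)
  (l : 'I_#|out T i|) : child T (kid l) i.
Proof. by exists (out_arc l); first exact: tail_out_arc. Qed.

Definition subtree_of (N M : nat) (T : arborescence N M) :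
    forall i : 'I_N, subtree T i :=
  Fix (@child_wf N M T) (subtree T) (fun i rec =>
    match boolP (leaf T i) with
    | AltTrue h => Leaf h
    | AltFalse h => Inner h (fun l => rec (kid l) (kid_child l))
    end).

(** * Tree-structured data and the nested matrices *)

Record tree_data (R : realType) (N M : nat) (T : arborescence N M) := TreeData {
  vdim : 'I_N -> nat;
  adim : 'I_M -> nat;
  B : forall i, 'M[R]_(vdim i);
  D : forall k, 'M[R]_(adim k);
  Cp : forall k, 'M[R]_(adim k, vdim (arb_tail T k));
  Cm : forall k, 'M[R]_(adim k, vdim (arb_head T k));
  B_sym : forall i, (B i)^T = B i;
  D_sym : forall k, (D k)^T = D k }.

(** [A] seen as a block in block column [b] of a block matrix with column sizes
    [q], when [A] belongs to block column [a]: it is [A] if [a = b], and 0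
    otherwise. *)
Definition at_block (R : realType) (I : eqType) (q : I -> nat) (m : nat)
    (a b : I) (A : 'M[R]_(m, q a)) : 'M[R]_(m, q b) :=
  if a =P b is ReflectT e then castmx (erefl m, congr1 q e) A else 0.

(** Block diagonal matrix with rectangular blocks (those of [mxdiag] are
    square). *)
Definition blkdiag (R : realType) (r : nat) (p q : 'I_r -> nat)
    (A : forall l, 'M[R]_(p l, q l)) : 'M[R]_(\sum_l p l, \sum_l q l) :=
  \mxblock_(a, b) at_block b (A a).

Definition posdefmx (R : realType) (n : nat) (A : 'M[R]_n) : Prop :=
  forall x : 'cV[R]_n, x != 0 -> 0 < (x^T *m A *m x) 0 0.

(** A program returns its result together with the log of the systems it solved:
    the vertex [i] occurs in the log once for each solution of a system with
    matrix [B i]. *)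
Definition prog (N : nat) (A : Type) : Type := (A * seq 'I_N)%type.

Definition ret (N : nat) (A : Type) (a : A) : prog N A := (a, [::]).

Definition bind (N : nat) (A A' : Type) (c : prog N A) (f : A -> prog N A') :
    prog N A' :=
  let: (a, s) := c in let: (a', s') := f a in (a', s ++ s').

(** Runs each of the programs [c l] once. *)
Definition for_all (N r : nat) (A : 'I_r -> Type) (c : forall l, prog N (A l)) :
    prog N (forall l, A l) :=
  (fun l => (c l).1, flatten [seq (c l).2 | l <- enum 'I_r]).

Definition solves (N : nat) (A : Type) (c : prog N A) (i : 'I_N) : nat :=
  count_mem i c.2.

(** [f] applies the inverse of the (invertible) matrix [P]. *)
Definition applies_inverse (R : realType) (N n : nat)
    (f : 'cV[R]_n -> prog N 'cV[R]_n) (P : 'M[R]_n) : Prop :=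
  P \in unitmx /\ forall g, (f g).1 = invmx P *m g.

Section Nested.
Context {R : realType} {N M : nat} {T : arborescence N M}.
Context (X : tree_data R T).

Fixpoint tdim (i : 'I_N) (t : subtree T i) : nat :=
  match t with
  | Leaf i _ => vdim X i
  | Inner i _ ts =>
      (\sum_(l < #|out T i|) tdim (ts l) + vdim X i
       + \sum_(l < #|out T i|) adim X (out_arc l))%N
  end.

(** [A |-> (0 ... 0 A 0)], with [A] in the columns of the diagonal block [B i]. *)
Definition pad (i : 'I_N) (t : subtree T i) (m : nat) :
    'M[R]_(m, vdim X i) -> 'M[R]_(m, tdim t) :=
  match t in subtree _ i return 'M[R]_(m, vdim X i) -> 'M[R]_(m, tdim t) with
  | Leaf i _ => fun A => A
  | Inner i _ ts => fun A => row_mx (row_mx 0 A) 0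
  end.

(** For an inner vertex [i] with subtrees [ts]: the matrices D_{<=i}, C^+_{<=i}
    and C^-_{<=i}.  The arc entering [kid l] is [out_arc l], so that the [l]-th
    diagonal block of C^-_{<=i} is [pad (ts l) (Cm X (out_arc l))]. *)
Definition nestD (i : 'I_N) :
    'M[R]_(\sum_(l < #|out T i|) adim X (out_arc l)) :=
  \mxdiag_l D X (out_arc l).

Definition nestCp (i : 'I_N) :
    'M[R]_(\sum_(l < #|out T i|) adim X (out_arc l), vdim X i) :=
  \mxcol_l castmx (erefl, congr1 (vdim X) (tail_out_arc l)) (Cp X (out_arc l)).

Definition nestCm (i : 'I_N) (ts : forall l : 'I_#|out T i|, subtree T (kid l)) :
    'M[R]_(\sum_(l < #|out T i|) adim X (out_arc l), \sum_l tdim (ts l)) :=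
  blkdiag (fun l => pad (ts l) (Cm X (out_arc l))).

Fixpoint nestB (i : 'I_N) (t : subtree T i) : 'M[R]_(tdim t) :=
  match t return 'M[R]_(tdim t) with
  | Leaf i _ => B X i
  | Inner i _ ts =>
      block_mx
        (block_mx (\mxdiag_l nestB (ts l)) 0 0 (B X i))
        (col_mx (- (nestCm ts)^T) (nestCp i)^T)
        (row_mx (- nestCm ts) (nestCp i))
        (- nestD i)
  end.

Definition schur (i : 'I_N) (ts : forall l : 'I_#|out T i|, subtree T (kid l)) :
    'M[R]_(\sum_(l < #|out T i|) adim X (out_arc l)) :=
  row_mx (- nestCm ts) (nestCp i)
    *m block_mx (\mxdiag_l invmx (nestB (ts l))) 0 0 (invmx (B X i))
    *m (row_mx (- nestCm ts) (nestCp i))^T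
  + nestD i.

Definition globalC :
    'M[R]_(\sum_(k < M) adim X k, \sum_(i < N) vdim X i) :=
  \mxblock_(k, i) (at_block i (Cp X k) - at_block i (Cm X k)).

(** Positive definiteness of the Schur complement is required at the inner
    vertices only; there, the subtrees of the children are again those given by
    [subtree_of]. *)
Definition standing_assumptions : Prop :=
  [/\ forall i, B X i \in unitmx,
      forall i, nestB (subtree_of T i) \in unitmx,
      forall i, ~~ leaf T i ->
        posdefmx (schur (fun l : 'I_#|out T i| => subtree_of T (kid l)))
    & posdefmx (globalC *m invmx (\mxdiag_i B X i) *m globalC^T
                + \mxdiag_k D X k)].

(** * Preconditioners *)

Definition hookmx (i : 'I_N) (ts : forall l : 'I_#|out T i|, subtree T (kid l))
    (Q : forall l, 'M[R]_(tdim (ts l))) :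
    'M[R]_(\sum_l tdim (ts l) + vdim X i
           + \sum_(l < #|out T i|) adim X (out_arc l)) :=
  block_mx
    (block_mx (\mxdiag_l Q l) 0 0 (B X i)) 0
    (row_mx (- nestCm ts) (nestCp i)) (- schur ts).

Fixpoint Phook (i : 'I_N) (t : subtree T i) : 'M[R]_(tdim t) :=
  match t return 'M[R]_(tdim t) with
  | Leaf i _ => B X i
  | Inner i _ ts => hookmx (fun l => Phook (ts l))
  end.

Fixpoint Pexact (i : 'I_N) (t : subtree T i) : 'M[R]_(tdim t) :=
  match t return 'M[R]_(tdim t) with
  | Leaf i _ => B X i
  | Inner i h ts =>
      let Prec := hookmx (fun l => Pexact (ts l)) in
      invmx ((2%:R%:M - invmx Prec *m nestB (Inner h ts)) *m invmx Prec)
  end.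

(** * Application procedures *)

Definition solveB (i : 'I_N) (g : 'cV[R]_(vdim X i)) : prog N 'cV[R]_(vdim X i) :=
  (invmx (B X i) *m g, [:: i]).

(** Application of the inverse of [hookmx Q], where [q l] is a program applying
    the inverse of [Q l]. *)
Definition apply_hookmx (i : 'I_N)
    (ts : forall l : 'I_#|out T i|, subtree T (kid l))
    (q : forall l, 'cV[R]_(tdim (ts l)) -> prog N 'cV[R]_(tdim (ts l)))
    (v : 'cV[R]_(\sum_l tdim (ts l) + vdim X i
                 + \sum_(l < #|out T i|) adim X (out_arc l))) :
    prog N 'cV[R]_(\sum_l tdim (ts l) + vdim X i
                 + \sum_(l < #|out T i|) adim X (out_arc l)) :=
  let g := usubmx (usubmx v) in
  let h := dsubmx (usubmx v) in
  let f := dsubmx v in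
  bind (for_all (fun l => q l (submxcol g l))) (fun xs =>
  bind (solveB h) (fun xi =>
  let x := \mxcol_l xs l in
  let z := - nestCm ts *m x + nestCp i *m xi - f in
  ret N (col_mx (col_mx x xi) (invmx (schur ts) *m z)))).

Fixpoint apply_hook (i : 'I_N) (t : subtree T i) :
    'cV[R]_(tdim t) -> prog N 'cV[R]_(tdim t) :=
  match t return 'cV[R]_(tdim t) -> prog N 'cV[R]_(tdim t) with
  | Leaf i _ => fun h => solveB h
  | Inner i _ ts => apply_hookmx (fun l => @apply_hook _ (ts l))
  end.

Fixpoint apply_exact (i : 'I_N) (t : subtree T i) :
    'cV[R]_(tdim t) -> prog N 'cV[R]_(tdim t) :=
  match t return 'cV[R]_(tdim t) -> prog N 'cV[R]_(tdim t) with
  | Leaf i _ => fun h => solveB h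
  | Inner i il ts => fun h =>
      let apply_rec := apply_hookmx (fun l => @apply_exact _ (ts l)) in
      bind (apply_rec h) (fun w =>
      bind (apply_rec (nestB (Inner il ts) *m w)) (fun y =>
      ret N (2%:R *: w - y)))
  end.

End Nested.

Arguments apply_hook {R N M T} X {i} t _.
Arguments apply_exact {R N M T} X {i} t _.

(* Main.v *)
Require Import Defs.
From mathcomp Require Import all_boot all_order all_algebra.
From mathcomp Require Import boolp reals.
Import Order.TTheory GRing.Theory Num.Theory.
Local Open Scope ring_scope.

(** The two parts of the result are a correctness statement and a count, and
    they are independent of each other.

    Correctness.  Forward substitution in the block lower triangular matrix
    [hookmx Q] is exactly what [apply_hookmx] does ([apply_hookmx_correct]), so
    for the hook preconditioner it suffices that the diagonal blocks are
    invertible, which follows from the standing assumptions by induction on the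
    tree.  For the exact preconditioner the invertibility of its defining
    expression is not immediate.  It holds because the preconditioner really is
    exact: with [P] the triangular matrix of [hookmx] built from the exact
    blocks and [K] the nested matrix, [K = P U] where [U] is unit block upper
    triangular with a single off-diagonal block, so that [(U - 1)^2 = 0], i.e.
    [2 - U] is the inverse of [U], and
    [(2 - P^-1 K) P^-1 = U^-1 P^-1 = K^-1] ([exact_two_steps]).  By induction
    the exact preconditioner is the nested matrix itself ([Pexact_nestB]), which
    is invertible by assumption.

    Count.  Both procedures call, at an inner vertex, the procedures of all
    children and one solve with the local block, and do this [m] times, with
    [m = 1] for the hook and [m = 2] for the exact preconditioner.  Hence the
    number of solves at [i] is multiplied by [m] along each arc of the path
    leading to [i], and once more at [i] itself if [i] is not a leaf
    ([visits_walk]).  Only one child contributes at each step because walks in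
    an arborescence are determined by their end points ([walk_inj]).  For
    [m = 2] this gives [2 ^ depth i] at leaves and [2 ^ (depth i + 1)] at inner
    vertices, hence the constants 1 and 2. *)

Set Implicit Arguments.
Unset Strict Implicit.
Unset Printing Implicit Defensive.

(** * Block matrices *)

Lemma unitmx_mxdiag (F : fieldType) (r : nat) (p : 'I_r -> nat)
    (Q : forall l, 'M[F]_(p l)) :
  (forall l, Q l \in unitmx) -> \mxdiag_l Q l \in unitmx.
Proof.
move=> uQ; rewrite -row_free_unit /row_free rank_mxdiag; apply/eqP/eq_bigr.
by move=> l _; apply: mxrank_unit.
Qed.

Lemma invmx_mxdiag (F : fieldType) (r : nat) (p : 'I_r -> nat)
    (Q : forall l, 'M[F]_(p l)) :
  (forall l, Q l \in unitmx) ->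
  invmx (\mxdiag_l Q l) = \mxdiag_l invmx (Q l).
Proof.
move=> uQ; have uD := unitmx_mxdiag uQ.
suff QV : \mxdiag_l Q l *m \mxdiag_l invmx (Q l) = 1%:M.
  by rewrite -[RHS](mulKmx uD) QV mulmx1.
rewrite -(mxdiagZ (p_ := p)) {2}/mxdiag mul_mxdiag_mxblock.
apply: eq_mxblock => a b; case: eqP => [ab|_]; last by rewrite mulmx0.
by case: b / ab; rewrite !conform_mx_id mulmxV.
Qed.

Lemma posdefmx_unit (R : realType) (n : nat) (A : 'M[R]_n) :
  posdefmx A -> A \in unitmx.
Proof.
move=> pA; rewrite unitmxE unitfE; apply/negP => /det0P[v v0 vA].
have /pA : v^T != 0.
  by apply: contra_neq v0 => /(congr1 trmx); rewrite trmxK trmx0.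
by rewrite trmxK vA mul0mx mxE ltxx.
Qed.

Lemma unitmx_lblock (F : fieldType) (n m : nat) (A : 'M[F]_n)
    (C : 'M[F]_(m, n)) (S : 'M[F]_m) :
  A \in unitmx -> S \in unitmx -> block_mx A 0 C (- S) \in unitmx.
Proof.
move=> uA uS; rewrite unitmxE det_lblock unitrM -!unitmxE uA /=.
by rewrite -scaleN1r unitmxZ ?unitrN1.
Qed.

(** Two steps of the iteration preconditioned by the block triangular [P] solve
    the saddle point system [K] exactly, because [P^-1 K] is unipotent of
    order 2. *)
Lemma exact_two_steps (F : fieldType) (n m : nat) (A : 'M[F]_n)
    (C : 'M[F]_(m, n)) (D : 'M[F]_m) :
  let S := C *m invmx A *m C^T + D in
  let P := block_mx A 0 C (- S) in
  let K := block_mx A C^T C (- D) in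
  A \in unitmx -> S \in unitmx ->
  invmx ((2%:R%:M - invmx P *m K) *m invmx P) = K.
Proof.
move=> S P K uA uS; have uP : P \in unitmx by exact: unitmx_lblock.
pose U : 'M_(n + m) := block_mx 1%:M (invmx A *m C^T) 0 1%:M.
(* The lower right block is where the definition of the Schur complement
   enters. *)
have PU : P *m U = K.
  rewrite mulmx_block !mulmx1 !mul0mx !mulmx0 mulKVmx // !addr0.
  by rewrite mulmxA opprD addNKr.
have -> : invmx P *m K = U by rewrite -PU mulKmx.
have VU : (2%:R%:M - U) *m U = 1%:M.
  have E k : 2%:R%:M - 1%:M = 1%:M :> 'M[F]_k.
    by rewrite -raddfB -[2%:R]/(1 + 1) addrK.
  rewrite scalar_mx_block opp_block_mx add_block_mx mulmx_block !E.
  rewrite oppr0 !addr0 !mul0mx !mulmx0 !mulmx1 !mul1mx !add0r addr0 subrr.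
  by rewrite -scalar_mx_block.
have [_ uU] := mulmx1_unit VU.
have uK : K \in unitmx by rewrite -PU unitmx_mul uP.
have -> : (2%:R%:M - U) *m invmx P = invmx K.
  by apply: (can_inj (mulmxK uK)); rewrite mulVmx // -PU mulmxA mulmxKV.
exact: invmxK.
Qed.

(** * Unfolding the subtrees *)

Lemma subtree_ofE (N M : nat) (T : arborescence N M) (i : 'I_N) :
  subtree_of T i = match boolP (leaf T i) with
    | AltTrue h => Leaf h
    | AltFalse h => Inner h (fun l => subtree_of T (kid l))
    end.
Proof.
rewrite /subtree_of Fix_eq // => {}i f g fg; congr (_ : subtree T i).
suff -> : f = g by [].
apply: functional_extensionality_dep => j.
by apply: functional_extensionality_dep => c; apply: fg.
Qed.

Lemma subtree_of_leaf (N M : nat) (T : arborescence N M) (i : 'I_N)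
  (h : leaf T i) : subtree_of T i = Leaf h.
Proof.
(* The index [b] is kept apart from [leaf T i], which also occurs in the types
   of the constructors, so that [s] can be analysed by cases. *)
have gen b (s : alt_spec (leaf T i) (leaf T i) b) ts :
    match s with AltTrue h' => Leaf h' | AltFalse h' => Inner h' ts end = Leaf h.
  by case: s => h'; [rewrite (bool_irrelevance h' h) | have := h'; rewrite h].
by rewrite subtree_ofE gen.
Qed.

Lemma subtree_of_inner (N M : nat) (T : arborescence N M) (i : 'I_N)
  (h : ~~ leaf T i) :
  subtree_of T i = Inner h (fun l => subtree_of T (kid l)).
Proof.
have gen b (s : alt_spec (leaf T i) (leaf T i) b) ts :
    match s with AltTrue h' => Leaf h' | AltFalse h' => Inner h' ts end
    = Inner h ts.
  by case: s => h'; [have := h; rewrite h' | rewrite (bool_irrelevance h' h)].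
by rewrite subtree_ofE gen.
Qed.

(** The standing assumptions only concern the subtrees [subtree_of T i], so the
    induction has to stay among them instead of ranging over all subtrees. *)
Lemma subtree_of_ind (N M : nat) (T : arborescence N M)
    (P : forall i, subtree T i -> Prop) :
  (forall i (h : leaf T i), P i (Leaf h)) ->
  (forall i (h : ~~ leaf T i),
     (forall l : 'I_#|out T i|, P (kid l) (subtree_of T (kid l))) ->
     P i (Inner h (fun l => subtree_of T (kid l)))) ->
  forall i, P i (subtree_of T i).
Proof.
move=> PL PI; apply: (well_founded_ind (@child_wf N M T)) => i IH.
case: (boolP (leaf T i)) => h; first by rewrite subtree_of_leaf.
by rewrite subtree_of_inner; apply: PI => l; apply: IH; apply: kid_child.
Qed.

(** * The procedures apply the inverses *)

Section Preconditioners.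
Context {R : realType} {N M : nat} {T : arborescence N M}.
Context (X : tree_data R T).

(** The procedure is forward substitution in a block lower triangular matrix:
    multiplying its result by [hookmx Q] gives back the argument. *)
Lemma apply_hookmx_correct (i : 'I_N)
    (ts : forall l : 'I_#|out T i|, subtree T (kid l)) q Q :
  (forall l, applies_inverse (q l) (Q l)) ->
  B X i \in unitmx -> schur X ts \in unitmx ->
  applies_inverse (apply_hookmx (X := X) (ts := ts) q) (hookmx Q).
Proof.
move=> qQ uB uS.
have uD : \mxdiag_l Q l \in unitmx by apply: unitmx_mxdiag => l; case: (qQ l).
have uH : hookmx Q \in unitmx.
  apply: unitmx_lblock => //.
  by rewrite unitmxE det_lblock unitrM -!unitmxE uD.
split=> // v; rewrite -[LHS](mulKmx uH); congr (_ *m _).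
rewrite -[v in RHS]vsubmxK -[usubmx v in RHS]vsubmxK /=.
rewrite /hookmx !mul_block_col mul_row_col !mul0mx !addr0 add0r mulKVmx //.
rewrite mul_mxdiag_mxcol.
under eq_mxcol => l do rewrite (proj2 (qQ l)) mulKVmx ?(proj1 (qQ l)) //.
by rewrite submxcolK !mulNmx mulKVmx // opprB addrC subrK.
Qed.

(** [exact_two_steps] at an inner vertex, with [A] the block diagonal matrix of
    the children's nested matrices and of the local block. *)
Lemma two_step_hookmx (i : 'I_N) (h : ~~ leaf T i)
    (ts : forall l : 'I_#|out T i|, subtree T (kid l)) :
  (forall l, nestB X (ts l) \in unitmx) ->
  B X i \in unitmx -> schur X ts \in unitmx ->
  let H := hookmx (fun l => nestB X (ts l)) in
  let K := nestB X (Inner h ts) in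
  invmx ((2%:R%:M - invmx H *m K) *m invmx H) = K.
Proof.
move=> uK uB uS /=.
have uD := unitmx_mxdiag uK.
have uA : block_mx (\mxdiag_l nestB X (ts l)) 0 0 (B X i) \in unitmx.
  by rewrite unitmxE det_lblock unitrM -!unitmxE uD.
have ES : schur X ts = row_mx (- nestCm X ts) (nestCp X i)
    *m invmx (block_mx (\mxdiag_l nestB X (ts l)) 0 0 (B X i))
    *m (row_mx (- nestCm X ts) (nestCp X i))^T + nestD X i.
  by rewrite invmx_block_diag // invmx_mxdiag.
have -> : col_mx (- (nestCm X ts)^T) (nestCp X i)^T
        = (row_mx (- nestCm X ts) (nestCp X i))^T.
  by rewrite tr_row_mx linearN.
by rewrite /hookmx ES; apply: exact_two_steps; rewrite // -ES.
Qed.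

Hypothesis SA : standing_assumptions X.

Lemma hook_correct (i : 'I_N) :
  applies_inverse (apply_hook X (subtree_of T i)) (Phook X (subtree_of T i)).
Proof.
have [uB uK pS _] := SA.
move: i; apply: (subtree_of_ind (P := fun i t =>
  applies_inverse (apply_hook X t) (Phook X t))) => [i h|i h IH].
  by split=> //; exact: uB.
by apply: apply_hookmx_correct; [exact: IH | exact: uB
                                | apply: posdefmx_unit; exact: pS].
Qed.

Lemma Pexact_nestB (i : 'I_N) :
  Pexact X (subtree_of T i) = nestB X (subtree_of T i).
Proof.
have [uB uK pS _] := SA.
move: i; apply: (subtree_of_ind (P := fun i t => Pexact X t = nestB X t)).
  by [].
move=> i h IH; rewrite /= /hookmx (eq_mxdiag IH) -/(hookmx _).
by apply: (two_step_hookmx h) => //; apply: posdefmx_unit; exact: pS.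
Qed.

Lemma bind_fst (A A' : Type) (c : prog N A) (f : A -> prog N A') :
  (bind c f).1 = (f c.1).1.
Proof. by case: c => a s /=; case: (f a). Qed.

Lemma exact_correct (i : 'I_N) :
  applies_inverse (apply_exact X (subtree_of T i)) (Pexact X (subtree_of T i)).
Proof.
have [uB uK pS _] := SA.
move: i; apply: (subtree_of_ind (P := fun i t =>
  applies_inverse (apply_exact X t) (Pexact X t))) => [i h|i h IH].
  by split=> //; exact: uB.
split; first by rewrite -subtree_of_inner Pexact_nestB.
move=> g; rewrite [LHS]bind_fst bind_fst.
have [_ H] := apply_hookmx_correct IH (uB i) (posdefmx_unit (pS i h)).
by rewrite invmxK !H -mulmxA mulmxBl mul_scalar_mx !mulmxA.
Qed.

End Preconditioners.

(** * Counting the solves *)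

Section Counting.
Context {N M : nat} {T : arborescence N M}.
Implicit Types (i v : 'I_N) (p q : seq 'I_M).

Local Notation twalk := (walk (arb_tail T) (arb_head T)).

(** Prefixing both walks with the walk from the root to [v] turns them into walks
    from the root to [i], and there is only one of these. *)
Lemma walk_inj v p q i : twalk v p i -> twalk v q i -> p = q.
Proof.
move=> wp wq; have [s ws] := arb_reach T v.
have cat_walk p' : twalk v p' i -> twalk (arb_root T) (s ++ p') i.
  by move=> w; rewrite walk_cat; apply/existsP; exists v; rewrite ws.
have [s0 [_ u]] := arb_walk T i.
have := etrans (esym (u _ (cat_walk _ wp))) (u _ (cat_walk _ wq)).
by move=> /eqP; rewrite eqseq_cat // eqxx => /eqP.
Qed.

Lemma walk_kid v (l : 'I_#|out T v|) p i :
  twalk (kid l) p i -> twalk v (out_arc l :: p) i.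
Proof. by move=> w /=; rewrite tail_out_arc eqxx. Qed.

(** The recurrence satisfied by the number of solves at [i] when every inner
    vertex runs its children and its own solve [m] times. *)
Fixpoint visits (m : nat) v (t : subtree T v) i : nat :=
  match t with
  | Leaf v _ => v == i
  | Inner v _ ts => (m * (\sum_l visits m (ts l) i + (v == i)))%N
  end.

Lemma visits_unreachable m v (t : subtree T v) i :
  (forall p, ~~ twalk v p i) -> visits m t i = 0%N.
Proof.
elim: t => [w lw|w iw ts IH] nw /=; first by have := nw [::] => /= /negbTE->.
rewrite big1 => [|l _]; first by have := nw [::] => /= /negbTE->; rewrite muln0.
by apply: IH => p; apply: contra (nw (out_arc l :: p)); apply: walk_kid.
Qed.

(** Each inner vertex on the walk contributes a factor [m]: its first arc leads
    into one child, and [i] is unreachable from the other children and different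
    from the starting vertex, since walks are unique. *)
Lemma visits_walk m v (t : subtree T v) p i : twalk v p i ->
  visits m t i = (m ^ size p * (if leaf T i then 1 else m))%N.
Proof.
elim: t p => [w lw|w iw ts IH] [|k p] /=.
- by move=> /eqP <-; rewrite lw eqxx.
- move=> /andP[kw _]; have : k \in out T w by rewrite inE.
  by move: lw => /eqP ->; rewrite inE.
- move=> /eqP wi; rewrite -{}wi (negbTE iw) eqxx big1 ?mul1n ?muln1 // => l _.
  (* A walk from a child back to [w] would close a cycle. *)
  apply: visits_unreachable => p; apply/negP => /walk_kid wc.
  by have := walk_inj wc (q := [::]) (eqxx w).
- move=> /andP[kw wp]; have kout : k \in out T w by rewrite inE.
  pose l := enum_rank_in kout k.
  have lk : out_arc l = k by rewrite /out_arc enum_rankK_in.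
  have wl : twalk (kid l) p i by rewrite /kid lk.
  have wlk := walk_kid wl.
  rewrite (bigD1 l) //= (IH l p wl) big1 => [|l' l'l].
    have -> : w == i = false.
      by apply/negP => /(walk_inj (p := [::])) /(_ wlk).
    by rewrite !addn0 expnS mulnA.
  apply: visits_unreachable => q; apply/negP => /walk_kid /walk_inj /(_ wlk).
  by case=> /enum_val_inj e _; rewrite e eqxx in l'l.
Qed.

Lemma solves_bind (A A' : Type) (c : prog N A) (f : A -> prog N A') i :
  solves (bind c f) i = (solves c i + solves (f c.1) i)%N.
Proof. by rewrite /solves; case: c => a s /=; case: (f a) => ? s'; rewrite count_cat. Qed.

Lemma solves_for_all (r : nat) (A : 'I_r -> Type) (c : forall l, prog N (A l)) i :
  solves (for_all c) i = (\sum_l solves (c l) i)%N.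
Proof.
by rewrite /solves count_flatten -map_comp sumnE big_map -big_enum.
Qed.

Context {R : realType} (X : tree_data R T).

Lemma solves_hookmx v (ts : forall l : 'I_#|out T v|, subtree T (kid l)) f n g i :
  (forall l h, solves (f l h) i = n l) ->
  solves (apply_hookmx (X := X) (ts := ts) f g) i = (\sum_l n l + (v == i))%N.
Proof.
move=> fn; rewrite /apply_hookmx !solves_bind solves_for_all.
under eq_bigr => l _ do rewrite fn.
by rewrite /solves /= !addn0.
Qed.

Lemma solves_hook v (t : subtree T v) g i :
  solves (apply_hook X t g) i = visits 1 t i.
Proof.
elim: t g => [w lw|w iw ts IH] g /=; first by rewrite /solves /= addn0.
by rewrite mul1n; apply: solves_hookmx.
Qed.

Lemma solves_exact v (t : subtree T v) g i :
  solves (apply_exact X t g) i = visits 2 t i.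
Proof.
elim: t g => [w lw|w iw ts IH] g; first by rewrite /solves /= addn0.
have fn l h : solves (apply_exact X (ts l) h) i = visits 2 (ts l) i by [].
rewrite [LHS]solves_bind (solves_hookmx _ fn) [in LHS]solves_bind.
by rewrite (solves_hookmx _ fn) /solves /= addn0 mul2n addnn.
Qed.

End Counting.

Theorem lemma3p5 (R : realType) :
  (forall (N M : nat) (T : arborescence N M) (X : tree_data R T),
     standing_assumptions X ->
     let P := Phook X (subtree_of T (arb_root T)) in
     let app := apply_hook X (subtree_of T (arb_root T)) in
     applies_inverse app P
     /\ forall g i, solves (app g) i = 1%N)
  /\
  (exists c C : R, 0 < c /\ c <= C /\
   forall (N M : nat) (T : arborescence N M) (X : tree_data R T),
     standing_assumptions X ->
     let P := Pexact X (subtree_of T (arb_root T)) in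
     let app := apply_exact X (subtree_of T (arb_root T)) in
     applies_inverse app P
     /\ forall g i,
          c * 2%:R ^+ depth T i <= (solves (app g) i)%:R
          /\ (solves (app g) i)%:R <= C * 2%:R ^+ depth T i).
Proof.
split=> [N M T X SA P app|].
  split=> [|g i]; first exact: hook_correct.
  have [p wp] := arb_reach T i.
  by rewrite solves_hook (visits_walk _ _ wp) exp1n; case: ifP.
exists 1, 2%:R; split; first exact: ltr01.
split=> [|N M T X SA P app]; first by rewrite ler1n.
split=> [|g i]; first exact: exact_correct.
rewrite solves_exact (visits_walk _ _ (xchooseP (arb_reach T i))).
rewrite -/(depth T i) natrM natrX mulrC.
split; last by rewrite [leRHS]mulrC ler_wpM2l ?exprn_ge0 //; case: ifP; rewrite ?ler1n.
by rewrite ler_wpM2l ?exprn_ge0 //; case: ifP; rewrite ?ler1n.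
Qed.
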